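(* Suppose the detector's and receiver's channels are independent binary symmetric channels with crossover probabilities $\epsilon_{\rm Dx}\in(0,1)\setminus\{\frac12\}$ and $\epsilon_{\rm Rx}\in(0,1)$ respectively, with innocent symbol $x_0=0$. Let $\epsilon_{\rm det},\epsilon_{\rm dec}\in(0,1)$ and $\xi=e^{-\frac12\mathsf{W}_0(4\epsilon_{\rm det}^2)}$. Then, using sparse signalling, there exists a code with $M$ code words of length $n$, with average decoding error probability not exceeding $\epsilon_{\rm dec}$ and probability of detection not exceeding $\epsilon_{\rm det}$, such that for any $0<\rho\le1$, $$\log_2M\ \ge\ \sqrt n\,\epsilon_{\rm det}\,L_{\rm BSC}(\rho,\epsilon_{\rm Rx},\epsilon_{\rm Dx})+\frac1\rho\log_2\epsilon_{\rm dec},$$ where $$L_{\rm BSC}(\rho,\epsilon_{\rm Rx},\epsilon_{\rm Dx})=\frac{2\xi}{\log2}\left(\frac{1+\rho}{\rho}\right)\frac{\sqrt{\epsilon_{\rm Dx}(1-\epsilon_{\rm Dx})}}{1-2\epsilon_{\rm Dx}}\left[(1-\epsilon_{\rm Rx})^{\frac{1}{1+\rho}}-\epsilon_{\rm Rx}^{\frac{1}{1+\rho}}\right]\left[(1-\epsilon_{\rm Rx})^{\frac{\rho}{1+\rho}}-\epsilon_{\rm Rx}^{\frac{\rho}{1+\rho}}\right].$$ In addition (with $M=M_n$ the sizes of such codes), $$\liminf_{n\to\infty}\frac{1}{\sqrt n}\log_2M_n\ \ge\ 2\,\epsilon_{\rm det}\,\xi\,\sqrt{\epsilon_{\rm Dx}(1-\epsilon_{\rm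 Dx})}\;\frac{1-2\epsilon_{\rm Rx}}{1-2\epsilon_{\rm Dx}}\,\log_2\left(\frac{1-\epsilon_{\rm Rx}}{\epsilon_{\rm Rx}}\right).$$
   Context: $\log$ is the natural logarithm and $\mathsf{W}_0$ the principal branch of the Lambert W function. A binary symmetric channel with crossover probability $\epsilon$ has input and output alphabet $\{0,1\}$ and flips its input with probability $\epsilon$. Setting: the transmitter uses a code, i.e. a list of $M$ code words in $\{0,1\}^n$, from an ensemble in which code words are generated independently with i.i.d. letters of distribution $p_X$. Sparse signalling means $p_X=(1-\tau)\delta_{x_0}+\tau p_{\tilde X}$ with sparseness factor $0\le\tau\le1$ and some kernel distribution $p_{\tilde X}$ on $\{0,1\}$. Messages are equally likely; message $m$ is sent by transmitting its code word over $n$ independent uses of the receiver's channel, the receiver knows the code, and a decoding error occurs when the decoded message differs from $m$; the average is over messages. The detector observes $\boldsymbol{w}\in\{0,1\}^n$ through its own channel $p_{W|X}$, does not know the code, only $p_X$, and tests the hypothesis $\mathcal{H}_0$: distribution $\prod_i p_{W|X}(w_i|x_0)$ (no transmission) against $\mathcal{H}_1$: distribution $\prod_i p_W(w_i)$ with $p_W(w)=\sum_x p_X(x)p_{W|X}(w|x)$. With $\alpha,\beta$ the false and miss detection probabilities, ''probability of detection not exceeding $\epsilon_{\rm det}$'' means that the test minimising $\alpha+\beta$ satisfies $\alpha+\beta\ge1-\epsilon_{\rm det}$.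
   Formalization: The code is claimed only for all sufficiently large n (threshold depending on the four parameters but not on ρ), since for fixed n the bound is impossible: as ε_Dx tends to 1/2 from below, L_BSC is unbounded, while the decoding error is at least 1−2^n/M. *)

(* Defs.v *)
From HB Require Import structures.
From mathcomp Require Import all_boot all_order all_algebra.
From mathcomp Require Import all_classical all_reals all_analysis.

Set Implicit Arguments.
Unset Strict Implicit.
Unset Printing Implicit Defensive.

Import Order.TTheory GRing.Theory Num.Theory.
Local Open Scope classical_set_scope.
Local Open Scope ring_scope.

(* On its domain x >= - e^-1, the constraint -1 <= w selects the principal
   branch; off that domain the value is 0. *)
Definition lambertW0 (R : realType) (x : R) : R :=
  xget 0 [set w : R | -1 <= w /\ w * expR w = x].

Definition log2 (R : realType) (x : R) : R := ln x / ln 2.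

Definition is_dist (R : realType) (T : finType) (p : T -> R) : Prop :=
  (forall x, 0 <= p x) /\ \sum_x p x = 1.

(* A channel is given by its transition probabilities W x y = p_{Y|X}(y|x). *)
Definition bsc (R : realType) (eps : R) (x y : bool) : R :=
  if x == y then 1 - eps else eps.

Definition sparse_dist (R : realType) (X : finType) (x0 : X) (tau : R)
    (kernel : X -> R) (x : X) : R :=
  (1 - tau) * (x == x0)%:R + tau * kernel x.

Definition output_dist (R : realType) (X Y : finType) (p : X -> R)
    (W : X -> Y -> R) (y : Y) : R :=
  \sum_x p x * W x y.

Definition word (T : finType) (n : nat) := {ffun 'I_n -> T}.

Definition iid_prob (R : realType) (T : finType) (n : nat) (p : T -> R)
    (s : word T n) : R :=
  \prod_i p (s i).

Definition channel_prob (R : realType) (X Y : finType) (n : nat)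
    (W : X -> Y -> R) (x : word X n) (y : word Y n) : R :=
  \prod_i W (x i) (y i).

Definition codebook (X : finType) (n M : nat) := {ffun 'I_M -> word X n}.

Definition code_prob (R : realType) (X : finType) (n M : nat) (p : X -> R)
    (C : codebook X n M) : R :=
  \prod_m iid_prob p (C m).

Definition decoding_error (R : realType) (X Y : finType) (n M : nat)
    (W : X -> Y -> R) (C : codebook X n M) (dec : word Y n -> 'I_M) : R :=
  M%:R^-1 * \sum_m \sum_(y | dec y != m) channel_prob W (C m) y.

(* A test is its rejection region T: the detector decides for H1 on w \in T. *)
Definition false_detection (R : realType) (X Y : finType) (n : nat) (x0 : X)
    (W : X -> Y -> R) (T : {set word Y n}) : R :=
  \sum_(w in T) iid_prob (W x0) w.

Definition miss_detection (R : realType) (X Y : finType) (n : nat) (p : X -> R)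
    (W : X -> Y -> R) (T : {set word Y n}) : R :=
  \sum_(w in ~: T) iid_prob (output_dist p W) w.

Definition test_error (R : realType) (X Y : finType) (n : nat) (x0 : X)
    (p : X -> R) (W : X -> Y -> R) (T : {set word Y n}) : R :=
  false_detection x0 W T + miss_detection p W T.

Definition optimal_test (R : realType) (X Y : finType) (n : nat) (x0 : X)
    (p : X -> R) (W : X -> Y -> R) (T : {set word Y n}) : Prop :=
  forall T' : {set word Y n}, test_error x0 p W T <= test_error x0 p W T'.

Definition detection_le (R : realType) (X Y : finType) (n : nat) (x0 : X)
    (p : X -> R) (W : X -> Y -> R) (eps : R) : Prop :=
  forall T : {set word Y n},
    optimal_test x0 p W T -> 1 - eps <= test_error x0 p W T.

(* The detector only knows the ensemble distribution, so detection constrains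
   the ensemble and not C itself.  For tau > 0 and a full-support kernel every
   code has positive probability, so membership of C in the ensemble would not
   tie C to tau; the tie is the bound on the error averaged over the ensemble,
   which is the random-coding guarantee. *)
Definition sparse_signalling_code (R : realType) (X W Y : finType) (x0 : X)
    (det : X -> W -> R) (rcv : X -> Y -> R) (eps_det eps_dec : R)
    (n M : nat) (C : codebook X n M) : Prop :=
  exists (tau : R) (kernel : X -> R) (dec : codebook X n M -> word Y n -> 'I_M),
    let p := sparse_dist x0 tau kernel in
    [/\ 0 <= tau <= 1, is_dist kernel, detection_le n x0 p det eps_det,
        \sum_(C' : codebook X n M) code_prob p C' * decoding_error rcv C' (dec C')
          <= eps_dec &
        0 < code_prob p C /\ decoding_error rcv C (dec C) <= eps_dec].

Definition xi (R : realType) (eps_det : R) : R :=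
  expR (- (1 / 2) * lambertW0 (4 * eps_det ^+ 2)).

Definition L_BSC (R : realType) (eps_det rho eps_rx eps_dx : R) : R :=
  2 * xi eps_det / ln 2 * ((1 + rho) / rho)
  * (Num.sqrt (eps_dx * (1 - eps_dx)) / (1 - 2 * eps_dx))
  * ((1 - eps_rx) `^ (1 / (1 + rho)) - eps_rx `^ (1 / (1 + rho)))
  * ((1 - eps_rx) `^ (rho / (1 + rho)) - eps_rx `^ (rho / (1 + rho))).

Definition rate_bound (R : realType) (eps_dx eps_rx eps_det eps_dec : R)
    (n M : nat) : Prop :=
  forall rho : R, 0 < rho <= 1 ->
    Num.sqrt n%:R * eps_det * L_BSC eps_det rho eps_rx eps_dx
      + 1 / rho * log2 eps_dec <= log2 M%:R.

(* Main.v *)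
Require Import Defs.
From HB Require Import structures.
From mathcomp Require Import all_boot all_order all_algebra.
From mathcomp Require Import all_classical all_reals all_analysis.
From mathcomp Require Import ring lra.

(** The input law is (1 - tau) delta_0 + tau delta_1 with tau = k / sqrt n.
    The total variation between the two hypotheses is bounded by a chi-square
    distance, so detection stays below eps_det as soon as
    n tau^2 (1 - 2 eps_dx)^2 / (eps_dx (1 - eps_dx)) <= ln (1 + 4 eps_det^2),
    and the largest such k is strictly larger than the coefficient kappa in the
    theorem, which corresponds to W0(4 eps_det^2) < ln (1 + 4 eps_det^2).  By
    Gallager's random-coding bound and (1 + u)^rho <= 1 + rho u, the averaged
    error with M + 1 code words is at most
    M^rho exp (- k sqrt n (1 + rho) D + O(rho)), where D >= d rho for some d > 0
    that does not depend on rho.  The gap (k - kappa) d rho sqrt n absorbs the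
    O(rho) term.  Finally one M has to serve all rho: take the least M meeting
    the rate bound for every rho; the bound then fails for M - 1 at some rho,
    and the random-coding bound at this rho yields the code. *)

Set Implicit Arguments.
Unset Strict Implicit.
Unset Printing Implicit Defensive.

Import Order.TTheory GRing.Theory Num.Theory numFieldNormedType.Exports.
Local Open Scope classical_set_scope.
Local Open Scope ring_scope.

(** * Inequalities for real powers *)

Lemma powR_prod (R : realType) (I : finType) (F : I -> R) (s : R) :
  (forall i, 0 <= F i) -> (\prod_i F i) `^ s = \prod_i F i `^ s.
Proof.
move=> F0; apply: (proj2 (_ : 0 <= \prod_i F i /\ _)).
elim/big_ind2: _ => [|x1 x2 y1 y2 [x0 <-] [y0 <-]|i _]; first by rewrite powR1.
- by rewrite powRM // mulr_ge0.
- by split.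
Qed.

(** Young's inequality for w^rho and 1 with exponents 1/rho and 1/(1 - rho); these degenerate at rho
    = 0 and rho = 1, which are settled first. *)
Lemma powR_le_affine (R : realType) (w rho : R) :
  0 <= w -> 0 <= rho <= 1 -> w `^ rho <= 1 - rho + rho * w.
Proof.
move=> w0 /andP[]; rewrite le_eqVlt => /predU1P[<- _|r0].
  by rewrite powRr0 subr0 mul0r addr0.
rewrite le_eqVlt => /predU1P[->|r1]; first by rewrite powRr1 // subrr mul1r add0r.
have s0 : 0 < 1 - rho by rewrite subr_gt0.
have := @conjugate_powR _ (w `^ rho) 1 rho^-1 (1 - rho)^-1 (powR_ge0 _ _) ler01.
rewrite !invr_gt0 !invrK => /(_ r0 s0); rewrite addrCA subrr addr0 => /(_ erefl).
by rewrite mulr1 powR1 -powRrM mulfV ?gt_eqF // powRr1 // mul1r; lra.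
Qed.

(** By concavity of z^rho, its graph lies below the tangent line at t; the affine bound is applied
    to z / t. *)
Lemma powR_le_tangent (R : realType) (t z rho : R) :
  0 < t -> 0 <= z -> 0 <= rho <= 1 ->
  z `^ rho <= t `^ rho * (1 - rho + rho * (z / t)).
Proof.
move=> t0 z0 r01; have zt0 : 0 <= z / t by rewrite divr_ge0 // ltW.
rewrite -[X in X `^ rho <= _](divfK (lt0r_neq0 t0)) powRM ?(ltW t0) // mulrC.
by rewrite ler_pM2l ?powR_gt0 // powR_le_affine.
Qed.

(** * Random-coding bound for general channels *)

Lemma expect_prod (R : realType) (A : finType) (M : nat) (P : A -> R)
    (G : 'I_M -> A -> R) :
  \sum_(C : {ffun 'I_M -> A}) (\prod_k P (C k)) * \prod_k G k (C k)
  = \prod_k \sum_x P x * G k x.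
Proof.
by rewrite bigA_distr_bigA; apply: eq_bigr => C _; rewrite big_split.
Qed.

(** Marginalisation: g (C m) is a product over all indices with factor 1 away from m, and those
    factors integrate to 1. *)
Lemma expect_codeword (R : realType) (A : finType) (M : nat) (P : A -> R)
    (P1 : \sum_x P x = 1) (m : 'I_M) (g : A -> R) :
  \sum_(C : {ffun 'I_M -> A}) (\prod_k P (C k)) * g (C m) = \sum_x P x * g x.
Proof.
transitivity (\sum_(C : {ffun 'I_M -> A}) (\prod_k P (C k)) *
    \prod_k (if k == m then g (C k) else 1)).
  by apply: eq_bigr => C _; rewrite -big_mkcond big_pred1_eq.
rewrite (expect_prod P (fun k x => if k == m then g x else 1)).
rewrite (bigD1 m) //= eqxx [X in _ * X]big1 ?mulr1 // => k /negbTE ->.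
by rewrite -[RHS]P1; apply: eq_bigr => x _; rewrite mulr1.
Qed.

Lemma expect_codeword_pair (R : realType) (A : finType) (M : nat) (P : A -> R)
    (P1 : \sum_x P x = 1) (m k : 'I_M) (g h : A -> R) :
  k != m ->
  \sum_(C : {ffun 'I_M -> A}) (\prod_j P (C j)) * (g (C m) * h (C k))
  = (\sum_x P x * g x) * \sum_x P x * h x.
Proof.
move=> km.
transitivity (\sum_(C : {ffun 'I_M -> A}) (\prod_k P (C k)) *
    \prod_j (if j == m then g (C j) else if j == k then h (C j) else 1)).
  apply: eq_bigr => C _; congr (_ * _).
  rewrite (bigD1 m) //= eqxx; congr (_ * _).
  rewrite (bigD1 k) //= (negbTE km) eqxx [X in _ * X]big1 ?mulr1 // => j.
  by case/andP=> /negbTE -> /negbTE ->.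
rewrite (expect_prod P (fun j x => if j == m then g x else if j == k then h x else 1)).
rewrite (bigD1 m) //= eqxx; congr (_ * _).
rewrite (bigD1 k) //= (negbTE km) eqxx [X in _ * X]big1 ?mulr1 // => j.
case/andP=> /negbTE -> /negbTE ->.
by rewrite -[RHS]P1; apply: eq_bigr => x _; rewrite mulr1.
Qed.

(* Gallager's bound.  Jensen's inequality for the rho-th power is replaced by
   the tangent line at the mean, which only needs independence in pairs. *)
Lemma random_coding_one_shot (R : realType) (A B : finType) (M : nat)
    (P : A -> R) (V : A -> B -> R) (rho : R) :
  0 < rho <= 1 -> (forall x, 0 <= P x) -> \sum_x P x = 1 ->
  (forall x y, 0 < V x y) -> (0 < M)%N ->
  exists dec : {ffun 'I_M.+1 -> A} -> B -> 'I_M.+1, forall m,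
    \sum_(C : {ffun 'I_M.+1 -> A}) (\prod_k P (C k)) *
        \sum_(y | dec C y != m) V (C m) y
    <= M%:R `^ rho * \sum_y (\sum_x P x * V x y `^ (1 + rho)^-1) `^ (1 + rho).
Proof.
move=> /andP[r0 r1] P0 P1 V0 M0.
(* Maximum-likelihood decoding among M + 1 code words, so that each message has exactly M
   competitors. *)
pose dec (C : {ffun 'I_M.+1 -> A}) y := [arg max_(k > ord0) V (C k) y]%O.
exists dec => m; set s := (1 + rho)^-1.
have rr : 1 + rho != 0 by rewrite gt_eqF // addr_gt0.
have MR : 0 < M%:R :> R by rewrite ltr0n.
pose a y := \sum_x P x * V x y `^ s.
have a_gt0 y : 0 < a y.
  rewrite lt_neqAle eq_sym sumr_ge0 ?andbT; last first.
    by move=> x _; rewrite mulr_ge0 // powR_ge0.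
  apply/eqP => a0; have P0E x : P x = 0.
    have /psumr_eq0P/(_ a0)/(_ x isT)/eqP : forall x : A, xpredT x -> 0 <= P x * V x y `^ s.
      by move=> z _; rewrite mulr_ge0 // powR_ge0.
    by rewrite mulf_eq0 (gt_eqF (powR_gt0 _ (V0 _ _))) orbF => /eqP.
  by move: P1 (oner_neq0 R); rewrite big1 // => <-; rewrite eqxx.
(* On a decoding error some competitor is at least as likely as C m, so V (C m) y ^ s is at most the
   sum Z of the competitors' powers. Since s (1 + rho) = 1, the likelihood is then at most V (C m) y
   ^ s times Z ^ rho, and the tangent at t makes this affine in Z. *)
have pt (C : {ffun 'I_M.+1 -> A}) y t : 0 < t ->
    (if dec C y != m then V (C m) y else 0) <=
    t `^ rho * (1 - rho) * V (C m) y `^ s +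
    t `^ rho * (rho / t) * \sum_(k | k != m) V (C m) y `^ s * V (C k) y `^ s.
  move=> t0; rewrite -mulr_sumr; set Z := \sum_(k | _) _.
  have Z0 : 0 <= Z by apply: sumr_ge0 => k _; apply: powR_ge0.
  rewrite (_ : _ + _ = V (C m) y `^ s * (t `^ rho * (1 - rho + rho * (Z / t))));
    last by ring.
  apply: (@le_trans _ _ (V (C m) y `^ s * Z `^ rho)); last first.
    by rewrite ler_pM2l ?powR_gt0 // powR_le_tangent // ltW.
  case: ifPn => [dm|_]; last by rewrite mulr_ge0 ?powR_ge0.
  have VZ : V (C m) y `^ s <= Z.
    rewrite /Z (bigD1 (dec C y)) //= ler_wpDr ?sumr_ge0 //.
      by move=> k _; apply: powR_ge0.
    apply: ge0_ler_powR; rewrite ?nnegrE ?(ltW (V0 _ _)) //.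
      by rewrite invr_ge0 ltW // addr_gt0.
    by rewrite /dec; case: arg_maxP => // k _; apply.
  apply: (@le_trans _ _ (V (C m) y `^ s * (V (C m) y `^ s) `^ rho)); last first.
    rewrite ler_pM2l ?powR_gt0 //.
    by apply: ge0_ler_powR => //; rewrite ?nnegrE ?powR_ge0 // ltW.
  rewrite -{1}(powRr1 (powR_ge0 (V (C m) y) s)) -powRD ?(negbTE rr) //.
  by rewrite -powRrM /s mulVf // powRr1 // ltW.
rewrite [X in X <= _](_ : _ = \sum_y \sum_(C : {ffun 'I_M.+1 -> A}) (\prod_k P (C k)) *
   (if dec C y != m then V (C m) y else 0)); last first.
  rewrite [RHS]exchange_big; apply: eq_bigr => C _.
  by rewrite -mulr_sumr -big_mkcond.
rewrite mulr_sumr; apply: ler_sum => y _; rewrite -/(a y).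
(* The tangent point is the mean of Z: M competitors contribute a y each. After averaging, the
   bracket 1 - rho + rho * (a y * M / t) is 1. *)
pose t := M%:R * a y; have t0 : 0 < t by rewrite mulr_gt0.
apply: (@le_trans _ _ (\sum_(C : {ffun 'I_M.+1 -> A}) (\prod_k P (C k)) *
   (t `^ rho * (1 - rho) * V (C m) y `^ s +
    t `^ rho * (rho / t) * \sum_(k | k != m) V (C m) y `^ s * V (C k) y `^ s))).
  by apply: ler_sum => C _; rewrite ler_wpM2l ?prodr_ge0 // pt.
under eq_bigr => C _ do rewrite mulrDr mulrCA [X in _ + X]mulrCA.
rewrite big_split /= -!mulr_sumr.
rewrite (expect_codeword P1 m (fun x => V x y `^ s)).
have -> : \sum_(C : {ffun 'I_M.+1 -> A}) (\prod_k P (C k)) *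
    (\sum_(k | k != m) V (C m) y `^ s * V (C k) y `^ s) =
    \sum_(k < M.+1 | k != m) a y * a y.
  under eq_bigr => C _ do rewrite mulr_sumr.
  rewrite exchange_big; apply: eq_bigr => k km.
  exact: (expect_codeword_pair P1 (fun x => V x y `^ s) (fun x => V x y `^ s) km).
rewrite sumr_const.
rewrite (_ : #|_| = M); last first.
  have := cardC1 m; rewrite card_ord /= => cM.
  by rewrite -[RHS]cM; apply: eq_card.
rewrite -/(a y) -[a y * a y *+ M]mulr_natr.
rewrite (powRD (r := 1)) ?(negbTE rr) // powRr1 ?(ltW (a_gt0 _)) //.
rewrite [X in _ <= X]mulrCA -powRM ?(ltW MR) ?(ltW (a_gt0 _)) // -/t.
rewrite (_ : _ + _ = t `^ rho * (a y * (1 - rho + rho * (a y * M%:R / t)))); last by ring.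
rewrite (_ : a y * M%:R / t = 1); last by rewrite /t [a y * _]mulrC mulfV // gt_eqF.
by rewrite mulr1 subrK mulr1 mulrC.
Qed.

Lemma sum_iid_prob (R : realType) (T : finType) (n : nat) (p : T -> R) :
  \sum_x p x = 1 -> \sum_(s : word T n) iid_prob p s = 1.
Proof.
move=> p1; rewrite /iid_prob -(bigA_distr_bigA (fun _ x => p x)) p1.
by rewrite big1.
Qed.

(** With i.i.d. letters and a memoryless channel, the sum in the one-shot bound factorises over
    positions into an n-th power. *)
Lemma random_coding (R : realType) (X Y : finType) (n M : nat) (p : X -> R)
    (W : X -> Y -> R) (rho : R) :
  0 < rho <= 1 -> is_dist p -> (forall x y, 0 < W x y) -> (0 < M)%N ->
  exists dec : codebook X n M.+1 -> word Y n -> 'I_M.+1,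
    \sum_C code_prob p C * decoding_error W C (dec C)
    <= M%:R `^ rho *
       (\sum_y (\sum_x p x * W x y `^ (1 + rho)^-1) `^ (1 + rho)) ^+ n.
Proof.
move=> r01 [p0 p1] W0 M0.
have P0 (s : word X n) : 0 <= iid_prob p s by apply: prodr_ge0.
have V0 (x : word X n) (y : word Y n) : 0 < channel_prob W x y by apply: prodr_gt0.
have [dec decP] := random_coding_one_shot r01 P0 (sum_iid_prob n p1) V0 M0.
exists dec; set b := (X in _ <= X).
have {}decP m : \sum_(C : codebook X n M.+1) code_prob p C *
    \sum_(y | dec C y != m) channel_prob W (C m) y <= b.
  apply: (le_trans (decP m)); rewrite /b ler_wpM2l ?powR_ge0 //.
  rewrite -[n in X in _ <= X]card_ord -prodr_const.
  rewrite bigA_distr_bigA; apply: ler_sum => y _.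
  rewrite -powR_prod => [|i]; last by apply: sumr_ge0 => x _; rewrite mulr_ge0 ?powR_ge0.
  rewrite (bigA_distr_bigA (fun i x => p x * W x (y i) `^ (1 + rho)^-1)).
  rewrite (eq_bigr (fun x : word X n =>
    \prod_i (p (x i) * W (x i) (y i) `^ (1 + rho)^-1))) // => x _.
  by rewrite big_split /= powR_prod // => i; rewrite ltW.
rewrite /decoding_error; under eq_bigr => C _ do rewrite mulrCA mulr_sumr.
rewrite -mulr_sumr exchange_big /= ler_pdivrMl ?ltr0n //.
apply: (le_trans (ler_sum _ (fun m _ => decP m))).
by rewrite sumr_const card_ord mulr_natl.
Qed.

(** If f exceeded eps on every code of positive probability, the terms [code_prob p C * (f C - eps)]
    would be nonnegative with sum at most 0. All would vanish, hence so would all probabilities,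
    which sum to 1. *)
Lemma exists_good_code (R : realType) (X : finType) (n M : nat) (p : X -> R)
    (f : codebook X n M -> R) (eps : R) :
  is_dist p -> \sum_C code_prob p C * f C <= eps ->
  exists C, 0 < code_prob p C /\ f C <= eps.
Proof.
move=> [p0 p1] feps; apply: contrapT => noC.
have prob0 (C : codebook X n M) : 0 <= code_prob p C.
  by apply: prodr_ge0 => m _; apply: prodr_ge0.
have prob1 : \sum_(C : codebook X n M) code_prob p C = 1.
  rewrite /code_prob -(bigA_distr_bigA (fun _ s => iid_prob p s)).
  by rewrite (sum_iid_prob n p1) big1.
have big C : 0 < code_prob p C -> eps < f C.
  by move=> C0; rewrite ltNge; apply/negP => fC; apply: noC; exists C.
have diff0 C : true -> 0 <= code_prob p C * (f C - eps).
  have := prob0 C; rewrite le_eqVlt => /predU1P[<- _|C0 _]; first by rewrite mul0r.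
  by rewrite mulr_ge0 // subr_ge0 ltW // big.
have sum_le0 : \sum_C code_prob p C * (f C - eps) <= 0.
  under eq_bigr => C _ do rewrite mulrBr.
  by rewrite sumrB -mulr_suml prob1 mul1r subr_le0.
have sum0 : \sum_C code_prob p C * (f C - eps) = 0.
  by apply/le_anti; rewrite sum_le0 sumr_ge0.
have zero (C : codebook X n M) : code_prob p C = 0.
  have /(_ C isT)/eqP := psumr_eq0P diff0 sum0.
  rewrite mulf_eq0 => /orP[/eqP //|/eqP fC].
  apply/eqP; apply: contraT => C0.
  have : 0 < code_prob p C by rewrite lt_neqAle eq_sym C0 prob0.
  by move/big; rewrite -subr_gt0 fC ltxx.
by move: prob1 (oner_neq0 R); rewrite big1 // => <-; rewrite eqxx.
Qed.

(** * Detection and the chi-square distance *)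

Lemma test_error_chi2 (R : realType) (X Y : finType) (n : nat) (x0 : X)
    (p : X -> R) (W : X -> Y -> R) (eps : R) (T : {set word Y n}) :
  0 < eps -> (forall y, 0 < W x0 y) ->
  \sum_y W x0 y = 1 -> \sum_y output_dist p W y = 1 ->
  (\sum_y output_dist p W y ^+ 2 / W x0 y) ^+ n <= 1 + 4 * eps ^+ 2 ->
  1 - eps <= test_error x0 p W T.
Proof.
move=> e0 q0_gt0 q01 q11; set q1 := output_dist p W in q11 *.
rewrite -[n in X in X -> _]card_ord -prodr_const bigA_distr_bigA => chi.
pose Q0 (w : word Y n) := iid_prob (W x0) w.
pose Q1 (w : word Y n) := iid_prob q1 w.
have Q0_gt0 w : 0 < Q0 w by apply: prodr_gt0.
have {}chi : \sum_w Q1 w ^+ 2 / Q0 w <= 1 + 4 * eps ^+ 2.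
  apply: le_trans chi; rewrite le_eqVlt; apply/orP; left; apply/eqP.
  by apply: eq_bigr => w _; rewrite /Q1 /Q0 /iid_prob -prodrXl -prodf_div.
(* A minorant of min (Q0, Q1). With r = Q1 / Q0, min (1, r) = (1 + r) / 2 - |r - 1| / 2, and |r - 1|
   / 2 <= (r - 1)^2 / (8 eps) + eps / 2 by AM-GM. Summed against Q0, a chi-square distance of at
   most 4 eps^2 costs eps / 2 + eps / 2. *)
pose g w := (Q0 w + Q1 w) / 2 - (Q1 w ^+ 2 / Q0 w - 2 * Q1 w + Q0 w) / (8 * eps)
            - eps / 2 * Q0 w.
have gle w : g w <= Q0 w /\ g w <= Q1 w.
  pose r := Q1 w / Q0 w; have rQ : Q1 w = r * Q0 w by rewrite /r divfK // gt_eqF.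
  have -> : g w = Q0 w * ((1 + r) / 2 - (r - 1) ^+ 2 / (8 * eps) - eps / 2).
    by rewrite /g rQ; field; rewrite !gt_eqF.
  have e1 : 1 - ((1 + r) / 2 - (r - 1) ^+ 2 / (8 * eps) - eps / 2)
     = (r - 1 - 2 * eps) ^+ 2 / (8 * eps) by field; rewrite gt_eqF.
  have e2 : r - ((1 + r) / 2 - (r - 1) ^+ 2 / (8 * eps) - eps / 2)
     = (r - 1 + 2 * eps) ^+ 2 / (8 * eps) by field; rewrite gt_eqF.
  rewrite rQ [r * _]mulrC -[X in _ <= X /\ _]mulr1 !ler_pM2l // -!(subr_ge0 _ 1) -!(subr_ge0 _ r).
  by rewrite e1 e2 !divr_ge0 ?sqr_ge0 // mulr_ge0 // ltW.
apply: (@le_trans _ _ (\sum_w g w)); last first.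
  rewrite /test_error /false_detection /miss_detection.
  rewrite (bigID (mem T)) /= lerD //; first by apply: ler_sum => w _; case: (gle w).
  under [X in _ <= X]eq_bigl => w do rewrite finset.in_setC.
  by apply: ler_sum => w _; case: (gle w).
rewrite /g !sumrB -!mulr_suml -mulr_sumr !big_split /= sumrN -mulr_sumr.
rewrite !sum_iid_prob //; set c := \sum_w _ in chi *.
rewrite (_ : _ - _ - _ = 1 - eps + (1 + 4 * eps ^+ 2 - c) / (8 * eps)); last first.
  by field; rewrite gt_eqF.
by rewrite lerDl divr_ge0 ?subr_ge0 // mulr_ge0 // ltW.
Qed.

(** The intermediate value theorem on [0, x], with x <= x e^x, shows that the set in [lambertW0] is
    inhabited, so [xget] does not return its default. The sign of w is that of w e^w. *)
Lemma lambertW0P (R : realType) (x : R) : 0 <= x ->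
  0 <= lambertW0 x /\ lambertW0 x * expR (lambertW0 x) = x.
Proof.
move=> x0; have [w1 we] : -1 <= lambertW0 x /\ lambertW0 x * expR (lambertW0 x) = x.
  apply: (@xgetPex _ 0 [set w : R | -1 <= w /\ w * expR w = x]).
  have cf : continuous (fun w : R => w * expR w).
    by move=> w; apply: cvgM; [exact: cvg_id|exact: continuous_expR].
  have xe : x <= x * expR x.
    by rewrite ler_peMr // -expR0 ler_expR.
  have := @IVT _ (fun w : R => w * expR w) 0 x x x0 (continuous_subspaceT cf).
  rewrite mul0r ge_min le_max x0 xe orbT => /(_ isT)[w].
  by rewrite in_itv /= => /andP[w0 _] ?; exists w; split=> //; lra.
by split=> //; rewrite -(pmulr_lge0 _ (expR_gt0 (lambertW0 x))) we.
Qed.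

(** * First-order exponent of the binary symmetric channel *)

Lemma powR_sub_ge (R : realType) (x y s : R) :
  0 < y <= x -> x <= 1 -> 0 <= s <= 1 -> s * (y * ln (x / y)) <= x `^ s - y `^ s.
Proof.
move=> /andP[y0 yx] x1 /andP[s0 s1]; have x0 := lt_le_trans y0 yx.
have l0 : 0 <= ln (x / y) by rewrite ln_ge0 // ler_pdivlMr // mul1r.
have -> : x `^ s = y `^ s * expR (s * ln (x / y)).
  rewrite -[in LHS](divfK (lt0r_neq0 y0) x) powRM ?divr_ge0 ?(ltW x0) ?(ltW y0) //.
  by rewrite mulrC [X in _ * X]/powR gt_eqF ?divr_gt0.
have := expR_ge1Dx (s * ln (x / y)); set E := expR _; set l := ln _ in l0 * => lE.
have ys : y <= y `^ s by rewrite ger1_powR // y0 (le_trans yx).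
rewrite -[X in _ <= _ - X]mulr1 -mulrBr mulrCA ler_pM // ?(ltW y0) ?mulr_ge0 //.
by rewrite lerBrDl.
Qed.

Lemma powR_sub_le (R : realType) (x y s : R) :
  0 < x <= 1 -> 0 < y -> 0 <= s -> x `^ s - y `^ s <= s * `|ln (x / y)|.
Proof.
move=> /andP[x0 x1] y0 s0.
have -> : y `^ s = x `^ s * expR (- (s * ln (x / y))).
  rewrite -[in LHS](divfK (lt0r_neq0 x0) y) powRM ?divr_ge0 ?(ltW x0) ?(ltW y0) //.
  rewrite mulrC [X in _ * X]/powR gt_eqF ?divr_gt0 //.
  by rewrite -mulrN -lnV ?posrE ?divr_gt0 // invf_div.
have := expR_ge1Dx (- (s * ln (x / y))); set E := expR _; set l := ln _ => lE.
have xs : x `^ s <= 1.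
  by rewrite -[X in _ <= X](powRr0 x) ger_powR // x0.
rewrite -[X in X - _]mulr1 -mulrBr.
apply: (@le_trans _ _ (x `^ s * (s * `|l|))); last first.
  by rewrite ler_piMl // mulr_ge0.
rewrite ler_wpM2l ?powR_ge0 //; have := ler_wpM2l s0 (ler_norm l); lra.
Qed.

(** This is the D of the overview: the derivative at tau = 0 of Gallager's sum for the sparse input
    is -(1 + rho) times it. *)
Definition gallager_gap (R : realType) (e rho : R) : R :=
  ((1 - e) `^ (1 / (1 + rho)) - e `^ (1 / (1 + rho)))
  * ((1 - e) `^ (rho / (1 + rho)) - e `^ (rho / (1 + rho))).

Lemma gallager_gapC (R : realType) (e rho : R) :
  gallager_gap (1 - e) rho = gallager_gap e rho.
Proof. by rewrite /gallager_gap subKr; ring. Qed.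

(** Since 1 / (1 + rho) >= 1/2 and rho / (1 + rho) >= rho / 2, the first factor is bounded below by
    a constant and the second by a multiple of rho. The factor e (1 - e), in place of e, keeps the
    constant invariant under e -> 1 - e. *)
Lemma gallager_gap_ge (R : realType) (e rho : R) :
  0 < e < 1 -> 0 < rho <= 1 ->
  (e * (1 - e) * ln ((1 - e) / e) / 2) ^+ 2 * rho <= gallager_gap e rho.
Proof.
move=> /andP[e0 e1] /andP[r0 r1].
wlog eh : e e0 e1 / e <= 1 / 2.
  move=> wl; have [/wl|h] := leP e (1 / 2); first exact.
  rewrite -gallager_gapC; apply: le_trans (wl (1 - e) _ _ _); [rewrite subKr|lra..].
  rewrite -[(1 - e) / e]invf_div lnV ?posrE ?divr_gt0 ?subr_gt0 //.
  by rewrite le_eqVlt; apply/orP; left; apply/eqP; ring.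
set l := ln _; have l0 : 0 <= l by rewrite ln_ge0 // ler_pdivlMr //; lra.
have D0 : 0 < 1 + rho by lra.
have el : e * (1 - e) * l <= e * l.
  by rewrite ler_wpM2r // ler_piMr ?(ltW e0) //; lra.
have el0 : 0 <= e * (1 - e) * l by rewrite !mulr_ge0 //; lra.
have A : 1 / 2 * (e * (1 - e) * l) <= (1 - e) `^ (1 / (1 + rho)) - e `^ (1 / (1 + rho)).
  apply: (@le_trans _ _ (1 / (1 + rho) * (e * l))).
    by apply: ler_pM => //; rewrite ler_pdivrMr // mulrAC ler_pdivlMr //; lra.
  apply: powR_sub_ge; [apply/andP; split; lra|lra|].
  by rewrite divr_ge0 ?(ltW D0) //= ler_pdivrMr //; lra.
have B : rho / 2 * (e * (1 - e) * l) <= (1 - e) `^ (rho / (1 + rho)) - e `^ (rho / (1 + rho)).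
  apply: (@le_trans _ _ (rho / (1 + rho) * (e * l))).
    apply: ler_pM => //; first by rewrite divr_ge0 // ltW.
    by rewrite ler_pM2l // lef_pV2 ?posrE //; lra.
  apply: powR_sub_ge; [apply/andP; split; lra|lra|].
  by rewrite divr_ge0 ?(ltW D0) ?(ltW r0) //= ler_pdivrMr //; lra.
rewrite (_ : _ * rho = (1 / 2 * (e * (1 - e) * l)) * (rho / 2 * (e * (1 - e) * l)));
  last by field.
by apply: ler_pM => //; rewrite mulr_ge0 //; lra.
Qed.

Lemma gallager_gap_ge0 (R : realType) (e rho : R) :
  0 < e < 1 -> 0 < rho <= 1 -> 0 <= gallager_gap e rho.
Proof.
move=> he r01; apply: le_trans (gallager_gap_ge he r01).
by case/andP: r01 => r0 _; rewrite mulr_ge0 ?sqr_ge0 // ltW.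
Qed.

(** The first factor is at most 1 and the second is O(rho). This keeps the rate bound finite as rho
    tends to 0. *)
Lemma gallager_gap_le (R : realType) (e rho : R) :
  0 < e < 1 -> 0 < rho <= 1 -> gallager_gap e rho <= `|ln ((1 - e) / e)| * rho.
Proof.
move=> /andP[e0 e1] /andP[r0 r1].
wlog eh : e e0 e1 / e <= 1 / 2.
  move=> wl; have [/wl|h] := leP e (1 / 2); first exact.
  rewrite -gallager_gapC; apply: (le_trans (wl (1 - e) _ _ _)); [lra..|rewrite subKr].
  rewrite -[(1 - e) / e]invf_div lnV ?posrE ?divr_gt0 ?subr_gt0 //.
  by rewrite normrN.
have D0 : 0 < 1 + rho by lra.
have e0' : 0 < 1 - e by lra.
rewrite mulrC -[X in _ <= X]mul1r; apply: ler_pM.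
- rewrite subr_ge0; apply: ge0_ler_powR; rewrite ?nnegrE ?divr_ge0 ?(ltW D0) ?(ltW e0) ?(ltW e0') //;
    lra.
- rewrite subr_ge0; apply: ge0_ler_powR; rewrite ?nnegrE ?divr_ge0 ?(ltW D0) ?(ltW e0) ?(ltW e0') ?(ltW r0) //;
    lra.
- apply: (@le_trans _ _ ((1 - e) `^ (1 / (1 + rho)))); first by rewrite gerBl powR_ge0.
  rewrite -[X in _ <= X](powRr0 (1 - e)) ger_powR ?divr_ge0 ?(ltW D0) //; apply/andP; split; lra.
apply: (le_trans (powR_sub_le _ _ _)) => //.
- by apply/andP; split; lra.
- by rewrite divr_ge0 ?(ltW D0) ?(ltW r0).
apply: ler_wpM2r => //.
by rewrite ler_pdivrMr // ler_peMr ?(ltW r0) //; lra.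
Qed.

Lemma is_derive_expRM (R : realType) (c s : R) :
  is_derive s 1 (fun x : R => expR (x * c)) (c * expR (s * c)).
Proof.
have h : is_derive s 1 (fun x : R => x * c) c.
  by apply: is_derive_eq; rewrite scaler0 add0r scaler1.
by rewrite mulrC; apply: (is_derive1_comp (f := expR) (g := fun x => x * c)).
Qed.

Lemma gallager_gap_lim (R : realType) (e eta : R) :
  0 < e < 1 -> 0 < eta ->
  exists2 rho, 0 < rho <= 1 &
    `|(1 - 2 * e) * ln ((1 - e) / e) - gallager_gap e rho * ((1 + rho) / rho)| < eta.
Proof.
move=> /andP[e0 e1] eta0; have e0' : 0 < 1 - e by lra.
(* In the variable s = rho / (1 + rho), the quantity becomes A(s) F(s) / s, with A(s) = (1 - e)^(1 -
   s) - e^(1 - s) tending to 1 - 2 e and F(s) / s to F'(0). *)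
pose F (s : R) := expR (s * ln (1 - e)) - expR (s * ln e).
have dF : is_derive (0 : R) 1 F (ln (1 - e) - ln e).
  have := is_deriveB (is_derive_expRM (ln (1 - e)) 0) (is_derive_expRM (ln e) 0).
  by rewrite !mul0r expR0 !mulr1.
have cB : h^-1 *: (F (h *: 1 + 0) - F 0) @[h --> 0^'+] --> ln (1 - e) - ln e.
  by apply: cvg_dnbhs_at_right; rewrite -(@derive_val _ _ _ _ _ _ _ dF); exact: ex_derive.
pose A (s : R) : R := (1 - e) * expR (s * - ln (1 - e)) - e * expR (s * - ln e).
have cA : A h @[h --> (0 : R)^'+] --> (1 - 2 * e : R).
  have ce c : expR (h * c) @[h --> (0 : R)^'+] --> (1 : R).
    rewrite -[X in _ --> X]expR0 -[X in _ --> expR X](mul0r c).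
    apply: cvg_at_right_filter.
    apply: (@differentiable_continuous _ _ _ (0 : R) (fun x : R => expR (x * c))).
    by apply/derivable1_diffP; exact: (@ex_derive _ _ _ _ _ _ _ (is_derive_expRM c 0)).
  rewrite (_ : 1 - 2 * e = (1 - e) * 1 - e * 1); last by ring.
  by apply: cvgB; apply: cvgMr.
have cAB : A h * (h^-1 * F h) @[h --> (0 : R)^'+] --> ((1 - 2 * e) * (ln (1 - e) - ln e) : R).
  apply: cvgM => //; move: cB.
  under eq_fun => h do rewrite scaler1 addr0 {2}/F !mul0r subrr subr0.
  exact.
move/cvgrPdist_lt: cAB => /(_ eta eta0) H3.
have : \forall s \near 0^'+, 0 < s :> R by exact: nbhs_right_gt.
(* Below 1/2, the value rho = s / (1 - s) is at most 1. *)
have : \forall s \near 0^'+, s < (1 / 2) :> R by apply: nbhs_right_lt; lra.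
move=> H1 H2.
have := @filter_ex _ (0 : R)^'+ _ _ (filterI (filterI H1 H2) H3).
case=> s [[s1 s0] sP].
have s1' : 0 < 1 - s by lra.
have r1 : 1 + s / (1 - s) = (1 - s)^-1 by field; rewrite gt_eqF.
exists (s / (1 - s)).
  by rewrite divr_gt0 //= ler_pdivrMr //; lra.
move: sP; rewrite ln_div ?posrE //; set l := ln _ - ln _.
rewrite /gallager_gap r1 invrK mul1r.

move=> sP; move: sP => /=; rewrite /A /F.
have xs x : 0 < x -> x * expR (s * - ln x) = x `^ (1 - s) /\ expR (s * ln x) = x `^ s.
  move=> x0; rewrite /powR gt_eqF //; split=> //.
  by rewrite -[in LHS](lnK (x := x)) ?posrE // -expRD; congr expR; rewrite expRK; ring.
have [-> ->] := xs _ e0'; have [-> ->] := xs _ e0.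
rewrite mulrA.
rewrite (_ : s / (1 - s) * (1 - s) = s); last by rewrite divfK // gt_eqF.
rewrite (_ : (1 - s)^-1 / (s / (1 - s)) = s^-1); last by field; rewrite !gt_eqF.
by rewrite -!mulrA [s^-1 * _]mulrC.
Qed.

(** * The sparse ensemble over the binary symmetric channel *)

Lemma powRD1_le (R : realType) (a w rho : R) :
  0 < a -> 0 <= a + w -> 0 <= rho <= 1 ->
  (a + w) `^ (1 + rho) <= a * a `^ rho + (1 + rho) * w * a `^ rho + rho * w ^+ 2 * (a `^ rho / a).
Proof.
move=> a0 aw r01; have r1 : 1 + rho != 0 by case/andP: r01 => *; rewrite gt_eqF //; lra.
rewrite powRD ?(negbTE r1) // powRr1 //.
(* Only the factor (a + w)^rho is replaced by its tangent at a, so the quadratic remainder keeps a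
   factor rho. *)
apply: (le_trans (ler_wpM2l aw (powR_le_tangent a0 aw r01))).
rewrite le_eqVlt; apply/orP; left; apply/eqP; field.
by rewrite gt_eqF.
Qed.

Lemma bsc_gt0 (R : realType) (e : R) x y : 0 < e < 1 -> 0 < bsc e x y.
Proof. by move=> /andP[e0 e1]; rewrite /bsc; case: eqP => _; lra. Qed.

Definition pulse (R : realType) (x : bool) : R := (x == true)%:R.

Lemma sparse_pulseE (R : realType) (tau : R) (x : bool) :
  sparse_dist false tau (@pulse R) x = if x then tau else 1 - tau.
Proof. by rewrite /sparse_dist /pulse; case: x; rewrite /= !(mulr0, mulr1, addr0, add0r). Qed.

Lemma sparse_pulse_dist (R : realType) (tau : R) : 0 <= tau <= 1 ->
  is_dist (sparse_dist false tau (@pulse R)).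
Proof.
move=> /andP[t0 t1]; split=> [x|]; first by rewrite sparse_pulseE; case: x; lra.
by rewrite big_bool !sparse_pulseE /=; lra.
Qed.

(** Expansion around tau = 0 at both outputs: the constant terms sum to 1, the linear ones give the
    gap exactly, and the remainder uses (b - a)^2 <= 1 and 1/e + 1/(1 - e) = 1/(e (1 - e)). *)
Lemma bsc_random_coding_exponent (R : realType) (e tau rho : R) :
  0 < e < 1 -> 0 <= tau <= 1 -> 0 < rho <= 1 ->
  \sum_y (\sum_x sparse_dist false tau (@pulse R) x * bsc e x y `^ (1 + rho)^-1) `^ (1 + rho)
  <= 1 - (1 + rho) * tau * gallager_gap e rho + rho * tau ^+ 2 / (e * (1 - e)).
Proof.
move=> he /andP[t0 t1] /andP[r0 r1]; have /andP[e0 e1] := he.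
have e0' : 0 < 1 - e by lra.
have r01 : 0 <= rho <= 1 by rewrite ltW.
have D0 : 0 < 1 + rho by lra.
rewrite big_bool !big_bool !sparse_pulseE /bsc /= /gallager_gap div1r.
have pw z : 0 < z -> [/\ 0 < z `^ (1 + rho)^-1, z `^ (1 + rho)^-1 * (z `^ (1 + rho)^-1) `^ rho = z,
   (z `^ (1 + rho)^-1) `^ rho = z `^ (rho / (1 + rho)) &
   z <= 1 -> z <= z `^ (1 + rho)^-1 <= 1 /\ z `^ (rho / (1 + rho)) <= 1].
  move=> z0; split; first exact: powR_gt0.
  - rewrite -{1}(powRr1 (powR_ge0 z (1 + rho)^-1)) -powRD ?(gt_eqF D0) //.
    by rewrite -powRrM mulVf ?gt_eqF // powRr1 // ltW.
  - by rewrite -powRrM mulrC.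
  move=> z1; split; first (apply/andP; split).
  - by rewrite ger1_powR ?z0 // invf_le1 //; lra.
  - by rewrite -[X in _ <= X](powRr0 z) ger_powR ?z0 // invr_ge0 ltW.
  - by rewrite -[X in _ <= X](powRr0 z) ger_powR ?z0 // divr_ge0 ?(ltW r0) // ltW.
have [a0 aE ar /(_ (ltW _))[|/andP[ea a1] ar1]] := pw (1 - e) e0'; first lra.
have [b0 bE br /(_ (ltW e1))[/andP[eb b1] br1]] := pw e e0.
set a := (1 - e) `^ _ in a0 aE ar ea a1 *; set b := e `^ _ in b0 bE br eb b1 *.
have h1 : 0 <= b + tau * (a - b).
  rewrite (_ : _ + _ = (1 - tau) * b + tau * a); last by ring.
  by rewrite addr_ge0 ?mulr_ge0 ?subr_ge0 ?(ltW a0) ?(ltW b0).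
have h0 : 0 <= a + tau * (b - a).
  rewrite (_ : _ + _ = (1 - tau) * a + tau * b); last by ring.
  by rewrite addr_ge0 ?mulr_ge0 ?subr_ge0 ?(ltW a0) ?(ltW b0).
rewrite (_ : tau * a + _ = b + tau * (a - b)); last by ring.
rewrite (_ : tau * b + _ = a + tau * (b - a)); last by ring.
apply: (le_trans (lerD (powRD1_le b0 h1 r01) (powRD1_le a0 h0 r01))).
rewrite aE bE ar br.
set a' := (1 - e) `^ _ in ar ar1 *; set b' := e `^ _ in br br1 *.
have a'0 : 0 <= a' by apply: powR_ge0.
have b'0 : 0 <= b' by apply: powR_ge0.
have ba : (b - a) ^+ 2 <= 1.
  rewrite -subr_ge0 (_ : _ - _ = (1 - (b - a)) * (1 + (b - a))); last by ring.
  by apply: mulr_ge0; move: a0 a1 b0 b1; clear; lra.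
have q1 : b' / b <= e^-1.
  by rewrite -[X in _ <= X]mul1r; apply: ler_pM => //; rewrite ?invr_ge0 ?(ltW b0) // lef_pV2.
have q2 : a' / a <= (1 - e)^-1.
  by rewrite -[X in _ <= X]mul1r; apply: ler_pM => //; rewrite ?invr_ge0 ?(ltW a0) // lef_pV2.
have qq : b' / b + a' / a <= (e * (1 - e))^-1.
  by rewrite (_ : (e * _)^-1 = e^-1 + (1 - e)^-1) ?lerD //; field; rewrite !gt_eqF.
have q0 : 0 <= b' / b + a' / a by rewrite addr_ge0 // divr_ge0 // ltW.
have key : (b - a) ^+ 2 * (b' / b + a' / a) <= (e * (1 - e))^-1.
  by rewrite -[X in _ <= X]mul1r; apply: ler_pM => //; apply: sqr_ge0.
have rt : 0 <= rho * tau ^+ 2 by rewrite mulr_ge0 ?sqr_ge0 // ltW.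
have := ler_wpM2l rt key; set q := _^-1; move: (b' / b) (a' / a); clear=> u v h; lra.
Qed.

(** A pulse shifts the output law by tau (1 - 2 e), so each letter contributes 1 + chi to the
    chi-square sum, and (1 + chi)^n <= e^(n chi). *)
Lemma bsc_test_error (R : realType) (e tau eps : R) (n : nat) :
  0 < e < 1 -> 0 < eps ->
  n%:R * (tau ^+ 2 * (1 - 2 * e) ^+ 2 / (e * (1 - e))) <= ln (1 + 4 * eps ^+ 2) ->
  detection_le n false (sparse_dist false tau (@pulse R)) (bsc e) eps.
Proof.
move=> he eps0 htau T _; have /andP[e0 e1] := he; have e0' : 0 < 1 - e by lra.
have eps1 : 0 < 1 + 4 * eps ^+ 2 by rewrite addr_gt0 // mulr_gt0 // exprn_gt0.
apply: test_error_chi2 => // [y| | |]; first exact: bsc_gt0.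
- by rewrite big_bool /bsc /=; lra.
- by rewrite /output_dist big_bool !big_bool !sparse_pulseE /bsc /=; ring.
rewrite /output_dist big_bool !big_bool !sparse_pulseE /bsc /=.
set chi := tau ^+ 2 * _ / _ in htau.
rewrite [X in X ^+ n](_ : _ = 1 + chi); last first.
  by rewrite /chi; field; rewrite !gt_eqF.
have chi0 : 0 <= chi by apply: divr_ge0; apply: mulr_ge0; rewrite ?sqr_ge0 // ltW.
apply: (@le_trans _ _ (expR chi ^+ n)).
  by rewrite lerXn2r ?nnegrE ?expR_ge0 ?addr_ge0 // expR_ge1Dx.
by rewrite -expRM_natl -[X in _ <= X]lnK ?posrE // ler_expR.
Qed.

Lemma sparse_code_exists (R : realType) (eps_dx eps_rx eps_det eps_dec tau : R)
    (n M : nat) (dec : codebook bool n M -> word bool n -> 'I_M) :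
  let p := sparse_dist false tau (@pulse R) in
  0 <= tau <= 1 -> detection_le n false p (bsc eps_dx) eps_det ->
  \sum_C code_prob p C * decoding_error (bsc eps_rx) C (dec C) <= eps_dec ->
  exists C : codebook bool n M, sparse_signalling_code false (bsc eps_dx)
    (bsc eps_rx) eps_det eps_dec C.
Proof.
move=> p t01 det avg.
have [C CP] := exists_good_code (sparse_pulse_dist t01) avg.
exists C, tau, (@pulse R), dec; split=> //; split=> [x|].
  by rewrite /pulse ler0n.
by rewrite big_bool /pulse /= addr0.
Qed.

(** At tau = 0 the two hypotheses coincide, and a single message is never decoded wrongly. *)
Lemma singleton_code_exists (R : realType) (eps_dx eps_rx eps_det eps_dec : R)
    (n : nat) :
  0 < eps_dx < 1 -> 0 < eps_det -> 0 < eps_dec ->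
  exists C : codebook bool n 1, sparse_signalling_code false (bsc eps_dx)
    (bsc eps_rx) eps_det eps_dec C.
Proof.
move=> hdx hdet hdec.
apply: (@sparse_code_exists _ _ _ _ _ 0 _ _ (fun _ _ => ord0)).
- by rewrite lexx ler01.
- apply: bsc_test_error => //; rewrite expr0n !mul0r mulr0 ln_ge0 // lerDl.
  by rewrite mulr_ge0 // sqr_ge0.
- rewrite big1 ?(ltW hdec) // => C _; rewrite /decoding_error big1 ?mulr0 // => m _.
  by rewrite big_pred0 // => y; rewrite (ord1 m) eqxx.
Qed.

(** * Asymptotic tools *)

Lemma near_sqrt_ge (R : realType) (B : R) :
  \forall n \near \oo, (0 < n)%N /\ B <= Num.sqrt n%:R.
Proof.
exists (Num.truncn (B ^+ 2)).+1 => // n /= Nn; split; first exact: leq_trans Nn.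
apply: (le_trans (ler_norm B)); rewrite -sqrtr_sqr ler_wsqrtr //.
by apply: (le_trans (ltW (truncnS_gt (B ^+ 2)))); rewrite ler_nat.
Qed.

Lemma le_limn_einf (R : realType) (u : nat -> R) (l : R) :
  (forall eta, 0 < eta -> \forall n \near \oo, l - eta <= u n) ->
  (l%:E <= limn_einf (fun n => (u n)%:E))%E.
Proof.
move=> H; apply/lee_addgt0Pr => eta /H [N _ HN].
rewrite -leeBlDr //.
rewrite limn_einf_lim (cvg_lim _ (@cvg_einfs_sup _ _)) //.
apply: le_trans (ereal_sup_ubound _); last by exists N.
apply: le_ereal_inf_tmp => _ [k /= Nk <-].
by rewrite -EFinB lee_fin; exact: HN.
Qed.

(** * The coefficient kappa and the rate bound *)

Definition sparsity_coef (R : realType) (eps_det eps_dx : R) : R :=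
  2 * eps_det * xi eps_det * (Num.sqrt (eps_dx * (1 - eps_dx)) / (1 - 2 * eps_dx)).

Lemma L_BSCE (R : realType) (eps_det rho eps_rx eps_dx : R) :
  eps_det * L_BSC eps_det rho eps_rx eps_dx =
  sparsity_coef eps_det eps_dx / ln 2 * (gallager_gap eps_rx rho * ((1 + rho) / rho)).
Proof. by rewrite /L_BSC /sparsity_coef /gallager_gap; ring. Qed.

(* The slack comes from e^w - 1 < w e^w = 4 eps_det^2 at w = W0(4 eps_det^2). *)
Lemma sparsity_coef_slack (R : realType) (eps_det eps_dx : R) :
  0 < eps_det -> 0 < eps_dx < 1 / 2 ->
  exists2 k, sparsity_coef eps_det eps_dx < k &
    k ^+ 2 * (1 - 2 * eps_dx) ^+ 2 / (eps_dx * (1 - eps_dx)) = ln (1 + 4 * eps_det ^+ 2).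
Proof.
move=> hdet /andP[e0 eh].
have v0 : 0 < eps_dx * (1 - eps_dx) by rewrite mulr_gt0 //; lra.
have u0 : 0 < 1 - 2 * eps_dx by lra.
have x0 : 0 < 4 * eps_det ^+ 2 by rewrite mulr_gt0 // exprn_gt0.
have [] := lambertW0P (ltW x0); rewrite /sparsity_coef /xi; set w := lambertW0 _ => w0 we.
have wn0 : w != 0 by apply/eqP => w00; move: we x0; rewrite w00 mul0r => <-; rewrite ltxx.
have wl : w < ln (1 + 4 * eps_det ^+ 2).
  rewrite -ltr_expR lnK ?posrE ?addr_gt0 // -we.
  have := @expR_gt1Dx _ (- w); rewrite oppr_eq0 => /(_ wn0).
  by rewrite -(ltr_pM2r (expR_gt0 w)) -expRD addNr expR0 mulrDl mul1r mulNr; lra.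
set c := ln _ in wl *; have c0 : 0 < c by apply: le_lt_trans wl.
set s := Num.sqrt (_ * _); have ss : s ^+ 2 = eps_dx * (1 - eps_dx) by rewrite sqr_sqrtr // ltW.
have s0 : 0 < s by rewrite sqrtr_gt0.
(* This k spends the chi-square budget exactly. As (2 eps_det xi)^2 = 4 eps_det^2 e^(-w) = w, kappa
   has the same form with w in place of c. *)
exists (Num.sqrt c * (s / (1 - 2 * eps_dx))).
  rewrite ltr_pM2r ?divr_gt0 // -[X in X < _]gtr0_norm ?mulr_gt0 ?expR_gt0 //.
  rewrite -sqrtr_sqr ltr_sqrt // !exprMn -expRM_natl.
  rewrite (_ : 2%:R * (- (1 / 2) * w) = - w); last by field.
  by rewrite expRN (_ : 2 ^+ 2 = 4) -?we ?mulfK ?gt_eqF ?expR_gt0 //; ring.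
by rewrite !exprMn sqr_sqrtr ?(ltW c0) // ss exprVn; field; rewrite !gt_eqF //; lra.
Qed.

Lemma log2_le0 (R : realType) (x : R) : x <= 1 -> log2 x <= 0.
Proof. by move=> x1; rewrite /log2 ler_pdivrMr ?ln_gt0 ?ltr1n // mul0r ln_le0. Qed.

Lemma rate_bound_exists (R : realType) (eps_dx eps_rx eps_det eps_dec : R) (n : nat) :
  0 < eps_rx < 1 -> 0 < eps_dec < 1 -> 0 <= sparsity_coef eps_det eps_dx ->
  exists M, rate_bound eps_dx eps_rx eps_det eps_dec n M.+1.
Proof.
move=> hrx /andP[_ d1] k0; have l2 : 0 < ln 2 :> R by rewrite ln_gt0 // ltr1n.
(* B dominates the bound for all rho at once: the gap over rho is at most the absolute logarithm,
   and 1 + rho <= 2. *)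
pose B := Num.sqrt n%:R *
  (sparsity_coef eps_det eps_dx / ln 2 * (`|ln ((1 - eps_rx) / eps_rx)| * 2)).
exists (Num.truncn (expR (B * ln 2))) => rho r01; have /andP[r0 r1] := r01.
apply: (@le_trans _ _ B).
  rewrite -[X in _ <= X]addr0 lerD //; last first.
    by rewrite mulr_ge0_le0 ?divr_ge0 ?(ltW r0) // log2_le0 // ltW.
  rewrite -mulrA L_BSCE !ler_wpM2l ?divr_ge0 ?(ltW l2) ?sqrtr_ge0 //.
  rewrite mulrCA (_ : _ * (_ / _) = gallager_gap eps_rx rho / rho * (1 + rho)); last by ring.
  apply: ler_pM; rewrite ?divr_ge0 ?gallager_gap_ge0 ?(ltW r0) //; last by lra.
    by lra.
  by rewrite ler_pdivrMr // gallager_gap_le.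
rewrite /log2 ler_pdivlMr // -ler_expR lnK ?posrE ?ltr0n //.
by rewrite ltW // truncnS_gt.
Qed.

Lemma bsc_random_coding_error (R : realType) (e kappa k eps_dec rho : R) (n M : nat) :
  0 < e < 1 -> 0 < rho <= 1 -> 0 < eps_dec -> 0 <= k -> (0 < M)%N ->
  (0 < n)%N -> k <= Num.sqrt n%:R ->
  k ^+ 2 / (e * (1 - e)) <=
    (k - kappa) * (e * (1 - e) * ln ((1 - e) / e) / 2) ^+ 2 * Num.sqrt n%:R ->
  kappa <= k ->
  log2 M%:R < Num.sqrt n%:R * (kappa / ln 2 * (gallager_gap e rho * ((1 + rho) / rho)))
     + 1 / rho * log2 eps_dec ->
  M%:R `^ rho * (\sum_y (\sum_x sparse_dist false (k / Num.sqrt n%:R) (@pulse R) x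
      * bsc e x y `^ (1 + rho)^-1) `^ (1 + rho)) ^+ n <= eps_dec.
Proof.
move=> he r01 d0 k0 M0 n0 ksq slack kk logM; have /andP[r0 r1] := r01.
have l2 : 0 < ln 2 :> R by rewrite ln_gt0 // ltr1n.
set q := Num.sqrt n%:R in ksq slack logM *.
have q0 : 0 < q by rewrite sqrtr_gt0 ltr0n.
have qq : n%:R = q ^+ 2 by rewrite sqr_sqrtr.
have t01 : 0 <= k / q <= 1 by rewrite divr_ge0 ?(ltW q0) //= ler_pdivrMr // mul1r.
set F := \sum_y _; set D := gallager_gap e rho in logM *.
have F0 : 0 <= F by apply: sumr_ge0 => y _; exact: powR_ge0.
have Fle := bsc_random_coding_exponent he t01 r01; rewrite -/F -/D in Fle.
set K := k ^+ 2 / _ in slack.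
(* Since n tau^2 = k^2, the quadratic term contributes rho K, with K independent of n. *)
pose E := - ((1 + rho) * k * q * D) + rho * K.
have FE : F ^+ n <= expR E.
  pose x := - ((1 + rho) * (k / q) * D) + rho * (k / q) ^+ 2 / (e * (1 - e)).
  have -> : E = n%:R * x.
    by rewrite /E /x /K qq; case/andP: he => *; field; rewrite !gt_eqF //; lra.
  rewrite expRM_natl lerXn2r ?nnegrE ?expR_ge0 //.
  by apply: le_trans (expR_ge1Dx _); rewrite /x addrA.
have logM' : rho * ln M%:R < q * kappa * (1 + rho) * D + ln eps_dec.
  have := logM; rewrite -(ltr_pM2r (mulr_gt0 r0 l2)) /log2.
  by rewrite [X in X < _](_ : _ = rho * ln M%:R)
    ?[X in _ < X](_ : _ = q * kappa * (1 + rho) * D + ln eps_dec) //;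
    field; rewrite !gt_eqF.
apply: (le_trans (ler_wpM2l (powR_ge0 _ _) FE)).
rewrite /powR pnatr_eq0 gtn_eqF // -expRD -[X in _ <= X]lnK ?posrE // ler_expR.
have Dge := gallager_gap_ge he r01; rewrite -/D in Dge; set d := _ ^+ 2 in slack Dge.
(* The surplus of k over kappa, with D >= d rho, pays for the remainder uniformly in rho. *)
have h1 : rho * K <= (k - kappa) * q * D.
  apply: (@le_trans _ _ ((k - kappa) * q * (d * rho))).
    by rewrite (_ : _ * (d * rho) = rho * ((k - kappa) * d * q)) ?ler_pM2l //; ring.
  by rewrite ler_wpM2l // mulr_ge0 ?subr_ge0 // ltW.
have D0 : 0 <= D by exact: gallager_gap_ge0.
have h2 : 0 <= (k - kappa) * q * D * rho.
  apply: mulr_ge0 (mulr_ge0 (mulr_ge0 _ (ltW q0)) D0) (ltW r0).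
  by rewrite subr_ge0.
rewrite /E; set l := rho * ln _ in logM' *; set z := ln eps_dec in logM' *.
have h2E : (k - kappa) * q * D * rho = (1 + rho) * k * q * D - q * kappa * (1 + rho) * D
  - (k - kappa) * q * D by ring.
by move: logM' h1 h2; rewrite h2E; clear; lra.
Qed.

(** Here the left side is at most 0 = log2 1: the gap vanishes for a receiver channel of pure noise,
    and otherwise kappa <= 0. *)
Lemma trivial_rate_bound (R : realType) (eps_dx eps_rx eps_det eps_dec : R) (n : nat) :
  0 < eps_rx < 1 -> 0 < eps_dec < 1 ->
  eps_rx = 1 / 2 \/ sparsity_coef eps_det eps_dx <= 0 ->
  rate_bound eps_dx eps_rx eps_det eps_dec n 1.
Proof.
move=> hrx /andP[_ d1] degen rho r01; have /andP[r0 r1] := r01.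
have l2 : 0 < ln 2 :> R by rewrite ln_gt0 // ltr1n.
rewrite {2}/log2 ln1 mul0r -[X in _ <= X]addr0 lerD //; last first.
  by rewrite mulr_ge0_le0 ?divr_ge0 ?(ltW r0) // log2_le0 // ltW.
rewrite -mulrA L_BSCE mulr_ge0_le0 ?sqrtr_ge0 //.
case: degen => [->|k0].
  rewrite /gallager_gap (_ : 1 - 1 / 2 = 1 / 2); last by field.
  by rewrite !subrr !mul0r mulr0.
rewrite mulr_le0_ge0 //; first by rewrite mulr_le0_ge0 // invr_ge0 ltW.
by rewrite mulr_ge0 ?gallager_gap_ge0 // divr_ge0 ?addr_ge0 ?(ltW r0).
Qed.

(** * Achievability and the limiting rate *)

Lemma achievability (R : realType) (eps_dx eps_rx eps_det eps_dec : R) :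
  0 < eps_dx < 1 -> eps_dx != 1 / 2 -> 0 < eps_rx < 1 ->
  0 < eps_det < 1 -> 0 < eps_dec < 1 ->
  \forall n \near \oo, exists (M : nat) (C : codebook bool n M),
    sparse_signalling_code false (bsc eps_dx) (bsc eps_rx) eps_det eps_dec C
    /\ rate_bound eps_dx eps_rx eps_det eps_dec n M.
Proof.
move=> hdx hdx2 hrx /andP[det0 _] hdec.
have [[dx0 dx1] [rx0 rx1]] := (andP hdx, andP hrx); have [dec0 _] := andP hdec.
have single n : rate_bound eps_dx eps_rx eps_det eps_dec n 1 ->
    exists (M : nat) (C : codebook bool n M),
    sparse_signalling_code false (bsc eps_dx) (bsc eps_rx) eps_det eps_dec C
    /\ rate_bound eps_dx eps_rx eps_det eps_dec n M.
  by move=> rb; have [C CP] := singleton_code_exists eps_rx n hdx det0 dec0; exists 1%N, C.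
set kappa := sparsity_coef eps_det eps_dx.
have [degen|] := pselect (eps_rx = 1 / 2 \/ kappa <= 0).
  by apply: filterE => n; apply: single; exact: trivial_rate_bound.
move=> /not_orP[rx2 /negP]; rewrite -ltNge => kappa0.
(* The sign of kappa is that of 1 - 2 eps_dx. *)
have dxh : 0 < eps_dx < 1 / 2.
  rewrite dx0 /= ltNge; apply/negP => h; move: kappa0; rewrite /kappa /sparsity_coef ltNge.
  rewrite mulr_ge0_le0 // ?mulr_ge0 ?expR_ge0 ?(ltW det0) //.
  by rewrite mulr_ge0_le0 ?sqrtr_ge0 // invr_le0; lra.
have [k kk kE] := sparsity_coef_slack det0 dxh.
have k0 : 0 < k by exact: lt_trans kk.
pose d := (eps_rx * (1 - eps_rx) * ln ((1 - eps_rx) / eps_rx) / 2) ^+ 2.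
have q0 : 0 < (1 - eps_rx) / eps_rx by rewrite divr_gt0 // subr_gt0.
have d0 : 0 < d.
  rewrite exprn_even_gt0 //= !mulf_neq0 ?invr_neq0 //; [lra..|].
  rewrite ln_eq0 //; apply/eqP => q1; apply: rx2.
  have : (1 - eps_rx) / eps_rx * eps_rx = eps_rx by rewrite q1 mul1r.
  by rewrite divfK ?gt_eqF //; lra.
have kd0 : 0 < (k - kappa) * d by rewrite mulr_gt0 // subr_gt0.
have near1 := near_sqrt_ge k.
have near2 := near_sqrt_ge (k ^+ 2 / (eps_rx * (1 - eps_rx)) / ((k - kappa) * d)).
apply: filterS (filterI near1 near2) => n [[n0 kn] [_]].
rewrite ler_pdivrMr // [_ * (_ * d)]mulrC => slack.
(* Positivity is required explicitly: [ln 0] is 0 by convention, so M = 0 would pass whenever M = 1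
   does. *)
have exM : exists M, (0 < M)%N && `[< rate_bound eps_dx eps_rx eps_det eps_dec n M >].
  have [M rM] := rate_bound_exists n hrx hdec (ltW kappa0).
  by exists M.+1; apply/asboolP.
(* A least M of 1 is served by the singleton code. Otherwise it is [M.+2], and the bound fails at
   [M.+1], which is exactly the number of competitors in the random-coding estimate for [M.+2] code
   words. *)
case: (ex_minnP exM) => -[//|[|M]] /andP[_ /asboolP rM] minM; first exact: single.
have : ~ rate_bound eps_dx eps_rx eps_det eps_dec n M.+1.
  by move=> /asboolP rM'; have := minM M.+1; rewrite rM' ltnn => /(_ isT).
move=> /existsNP[rho /not_implyP[r01 /negP]]; rewrite -ltNge -mulrA L_BSCE => fails.
have q1 : 0 < Num.sqrt n%:R :> R by rewrite sqrtr_gt0 ltr0n.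
have t01 : 0 <= k / Num.sqrt n%:R <= 1.
  by rewrite divr_ge0 ?(ltW k0) ?(ltW q1) //= ler_pdivrMr // mul1r.
have det : detection_le n false (sparse_dist false (k / Num.sqrt n%:R) (@pulse R))
    (bsc eps_dx) eps_det.
  apply: bsc_test_error => //; rewrite -kE expr_div_n sqr_sqrtr //.
  rewrite le_eqVlt; apply/orP; left; apply/eqP; field.
  by rewrite !gt_eqF ?ltr0n //; lra.
have [dec avg] := random_coding n r01 (sparse_pulse_dist t01)
  (fun x y => bsc_gt0 x y hrx) (ltn0Sn M).
have err := bsc_random_coding_error hrx r01 dec0 (ltW k0) (ltn0Sn M) n0 kn slack (ltW kk) fails.
have [C CP] := sparse_code_exists t01 det (le_trans avg err).
by exists M.+2, C.
Qed.

Lemma rate_liminf (R : realType) (eps_dx eps_rx eps_det eps_dec : R) (M : nat -> nat) :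
  0 < eps_rx < 1 ->
  (\forall n \near \oo, rate_bound eps_dx eps_rx eps_det eps_dec n (M n)) ->
  ((2 * eps_det * xi eps_det * Num.sqrt (eps_dx * (1 - eps_dx))
     * ((1 - 2 * eps_rx) / (1 - 2 * eps_dx))
     * log2 ((1 - eps_rx) / eps_rx))%:E
   <= limn_einf (fun n => ((Num.sqrt n%:R)^-1 * log2 (M n)%:R)%:E))%E.
Proof.
move=> hrx rateM; have l2 : 0 < ln 2 :> R by rewrite ln_gt0 // ltr1n.
apply: (@le_limn_einf _ (fun n => (Num.sqrt n%:R)^-1 * log2 (M n)%:R)) => eta eta0.
pose kl := sparsity_coef eps_det eps_dx / ln 2.
(* One rho, fixed by eta, suffices: it costs eta / 2, and the eps_dec term, divided by sqrt n,
   eventually costs at most another eta / 2. Adding 1 to |kl| guards against kl = 0. *)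
have kl1 : 0 < `|kl| + 1 by rewrite ltr_wpDl.
have eta1 : 0 < eta / 2 / (`|kl| + 1) by rewrite !divr_gt0.
have [rho r01] := gallager_gap_lim hrx eta1.
set t := (1 - 2 * eps_rx) * ln _; set G := gallager_gap _ _ * _ => tG.
have /andP[r0 _] := r01.
have near1 := near_sqrt_ge (`|1 / rho * log2 eps_dec| / (eta / 2)).
apply: filterS (filterI near1 rateM) => n [[n0 hn] /(_ rho r01)].
rewrite -mulrA L_BSCE -/kl -/G.
set q := Num.sqrt n%:R in hn *; have q0 : 0 < q by rewrite sqrtr_gt0 ltr0n.
set c := 1 / rho * _ in hn * => rb.
rewrite (_ : _ * log2 _ = kl * t); last by rewrite /kl /t /log2 /sparsity_coef; ring.
have klG : `|kl * t - kl * G| <= eta / 2.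
  rewrite -mulrBr normrM; apply: (@le_trans _ _ ((`|kl| + 1) * (eta / 2 / (`|kl| + 1)))).
    by apply: ler_pM => //; [rewrite lerDl|exact: ltW].
  by rewrite mulrC divfK // gt_eqF.
move: klG; rewrite ler_norml => /andP[_ klG].
have cq : - (eta / 2) <= q^-1 * c.
  move: hn; rewrite ler_pdivrMr ?divr_gt0 // => hn.
  rewrite -[- _](mulKf (lt0r_neq0 q0)) ler_pM2l ?invr_gt0 // mulrN.
  by have := ler_norm (- c); rewrite normrN; lra.
apply: (@le_trans _ _ (kl * G + q^-1 * c)); first lra.
by rewrite ler_pdivlMl // mulrDr mulVKf ?gt_eqF.
Qed.

Theorem theorem3 (R : realType) (eps_dx eps_rx eps_det eps_dec : R)
    (hdx : 0 < eps_dx < 1) (hdx2 : eps_dx != 1 / 2) (hrx : 0 < eps_rx < 1)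
    (hdet : 0 < eps_det < 1) (hdec : 0 < eps_dec < 1) :
  (exists N : nat, forall n : nat, (N <= n)%N ->
    exists (M : nat) (C : codebook bool n M),
      sparse_signalling_code false (bsc eps_dx) (bsc eps_rx) eps_det eps_dec C
      /\ rate_bound eps_dx eps_rx eps_det eps_dec n M)
  /\
  (forall (M : nat -> nat) (C : forall n : nat, codebook bool n (M n)),
    (\forall n \near \oo,
      sparse_signalling_code false (bsc eps_dx) (bsc eps_rx) eps_det eps_dec
        (C n)
      /\ rate_bound eps_dx eps_rx eps_det eps_dec n (M n)) ->
    ((2 * eps_det * xi eps_det * Num.sqrt (eps_dx * (1 - eps_dx))
       * ((1 - 2 * eps_rx) / (1 - 2 * eps_dx))
       * log2 ((1 - eps_rx) / eps_rx))%:E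
     <= limn_einf (fun n => ((Num.sqrt n%:R)^-1 * log2 (M n)%:R)%:E))%E).
Proof.
split=> [|M C rateM].
  have [N _ NP] := achievability hdx hdx2 hrx hdet hdec.
  by exists N => n Nn; apply: NP.
exact: rate_liminf hrx (filterS (fun n => @proj2 _ _) rateM).
Qed.
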